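(* Let $n>1$ and let $\Phi\in\mathcal X(\mathbf S^n,\mathbf S)$. (1) $\Phi$ is join-irreducible if and only if $\Phi=(0,\psi\wedge h,\psi)$ or $\Phi=(\psi,\psi,\psi\wedge h)$ for some join-irreducible $\psi\in\mathcal X(\mathbf S^{n-1},\mathbf S)$; i.e., if and only if $\Phi=\Psi\wedge\Pi_1$ or $\Phi=\Psi\wedge\overline{\Pi_1}$ for such a $\psi$, where $\Psi=(\psi,\psi,\psi)$. (2) When $\Phi\le h$, $\Phi$ is join-irreducible if and only if $\Phi=(0,\psi,\psi)$ or $\Phi=(\psi,\psi,\psi)$ for some join-irreducible $\psi\in\mathcal X(\mathbf S^{n-1},\mathbf S)$ with $\psi\le h$. (3) When $\Phi\nleq h$, $\Phi$ is join-irreducible if and only if $\Phi=(0,\psi\wedge h,\psi)$ or $\Phi=(\psi,\psi,\psi\wedge h)$ for some join-irreducible $\psi\in\mathcal X(\mathbf S^{n-1},\mathbf S)$ with $\psi\nleq h$.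
   Context: $S=\{0,h,1\}$ is the chain $0<h<1$ with $\wedge=\min$, $\vee=\max$, and the unary operation $\overline0=\overline h=1$, $\overline1=h$. Let $r_1=S^2\setminus\{(1,0)\}$, $r_2=S^2\setminus\{(h,0),(1,0)\}$, $r_3=S^2\setminus\{(0,1),(h,1),(1,0),(1,h)\}$, and $\mathbf S=\langle S;\{r_1,r_2,r_3\},\mathcal T\rangle$ with $\mathcal T$ discrete. For $m\ge1$, $\mathcal X(\mathbf S^m,\mathbf S)$ is the set of maps $f:S^m\to S$ preserving $r_1,r_2,r_3$ (for each $k$: if $(x_i,y_i)\in r_k$ for all $i$, then $(f(x),f(y))\in r_k$). It is a lattice under pointwise operations and order, closed under pointwise bar, and contains the constant maps $0,h,1$ (denoted by the same symbols). An element $f$ is join-irreducible if $f\ne0$ and $f=g\vee k$ with $g,k$ in the lattice implies $f=g$ or $f=k$. For $\psi,\psi',\psi'':S^{n-1}\to S$, $(\psi,\psi',\psi''):S^n\to S$ is the map sending $(x_1,\dots,x_n)$ to $\psi(x_2,\dots,x_n)$, $\psi'(x_2,\dots,x_n)$, $\psi''(x_2,\dots,x_n)$ according as $x_1=0$, $h$, $1$. $\Pi_1:S^n\to S$ is the first projection. *)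

(* Defs.v *)
From HB Require Import structures.
From mathcomp Require Import all_boot all_order.

Set Implicit Arguments.
Unset Strict Implicit.
Unset Printing Implicit Defensive.

Import Order.TTheory.

(* The chain 0 < h < 1; ['I_3] carries its canonical total order in
   [order_scope], whose [Order.min] and [Order.max] are the lattice operations. *)
Notation S3 := 'I_3.

Definition s0 : S3 := @Ordinal 3 0 isT.
Definition sh : S3 := @Ordinal 3 1 isT.
Definition s1 : S3 := @Ordinal 3 2 isT.

(* Not an involution: 1 is sent to h, not to 0. *)
Definition sbar (a : S3) : S3 := if a == s1 then sh else s1.

Definition r1 : {set S3 * S3} := ~: [set (s1, s0)].
Definition r2 : {set S3 * S3} := ~: [set (sh, s0); (s1, s0)].
Definition r3 : {set S3 * S3} :=
  ~: [set (s0, s1); (sh, s1); (s1, s0); (s1, sh)].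

Notation fS m := {ffun m.-tuple S3 -> S3}.

Definition preserves (m : nat) (r : {set S3 * S3}) (f : fS m) : bool :=
  [forall x : m.-tuple S3, forall y : m.-tuple S3,
     [forall i, (tnth x i, tnth y i) \in r] ==> ((f x, f y) \in r)].

(* The set of morphisms from S^m to S; the discrete topology on these finite
   structures imposes no further condition. *)
Definition XS (m : nat) : {set fS m} :=
  [set f | [&& preserves r1 f, preserves r2 f & preserves r3 f]].

Definition fcst (m : nat) (a : S3) : fS m := [ffun=> a].
Definition fmeet (m : nat) (f g : fS m) : fS m :=
  [ffun x => Order.min (f x) (g x)].
Definition fjoin (m : nat) (f g : fS m) : fS m :=
  [ffun x => Order.max (f x) (g x)].
Definition fbar (m : nat) (f : fS m) : fS m := [ffun x => sbar (f x)].
Definition fle (m : nat) (f g : fS m) : Prop := forall x, (f x <= g x)%O.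

Definition join_irreducible (m : nat) (f : fS m) : Prop :=
  [/\ f \in XS m, f <> fcst m s0 &
      forall g k : fS m, g \in XS m -> k \in XS m ->
        f = fjoin g k -> f = g \/ f = k].

Definition triple (m : nat) (p0 ph p1 : fS m) : fS m.+1 :=
  [ffun x : m.+1.-tuple S3 =>
     let y : m.-tuple S3 := [tuple of behead x] in
     if thead x == s0 then p0 y else if thead x == sh then ph y else p1 y].

Definition Pi1 (m : nat) : fS m.+1 := [ffun x : m.+1.-tuple S3 => thead x].

(* Main.v *)
(* Record x : S by the pair of bits ([x <> 0], [x = 1]).  The three relations
   then say that a morphism f is the same as a monotone Boolean function A
   (reading [f > 0] off the bits [x_i > 0]) together with an arbitrary Boolean
   function B <= A (reading [f = 1] off the bits [x_i = 1]).  The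
   join-irreducible pairs (A, B) are therefore (up-set of c, empty) and
   (up-set of c, {c}) for c a bit vector, and splitting off the first bit of c
   produces exactly the triples of the theorem. *)

Require Import Defs.
From HB Require Import structures.
From mathcomp Require Import all_boot all_order.

Set Implicit Arguments.
Unset Strict Implicit.
Unset Printing Implicit Defensive.

Import Order.TTheory.

(** * The relations and the morphisms in terms of bits *)

Lemma S3P (a : S3) : [\/ a = s0, a = sh | a = s1].
Proof.
by case: a => [[|[|[|//]]] ha];
  [constructor 1 | constructor 2 | constructor 3]; apply: val_inj.
Qed.

Lemma in_r1 a b : ((a, b) \in r1) = ((a == s1) ==> (b != s0)).
Proof. by rewrite !inE xpair_eqE negb_and implybE. Qed.

Lemma in_r2 a b : ((a, b) \in r2) = ((a != s0) ==> (b != s0)).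
Proof.
by rewrite !inE !xpair_eqE; case: (S3P a) => ->; case: (S3P b) => ->.
Qed.

Lemma in_r3 a b : ((a, b) \in r3) = ((a == s1) == (b == s1)).
Proof.
by rewrite !inE !xpair_eqE; case: (S3P a) => ->; case: (S3P b) => ->.
Qed.

Lemma max_eq1 (a b : S3) : (Order.max a b == s1) = (a == s1) || (b == s1).
Proof. by case: (S3P a) => ->; case: (S3P b) => ->. Qed.

Lemma max_neq0 (a b : S3) : (Order.max a b != s0) = (a != s0) || (b != s0).
Proof. by case: (S3P a) => ->; case: (S3P b) => ->. Qed.

Lemma preservesP m (r : {set S3 * S3}) (f : fS m) :
  reflect (forall x y : m.-tuple S3,
             (forall i, (tnth x i, tnth y i) \in r) -> (f x, f y) \in r)
          (preserves r f).
Proof.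
apply: (iffP forallP) => [H x y xy | H x].
  by move/forallP: (H x) => /(_ y)/implyP; apply; apply/forallP.
by apply/forallP => y; apply/implyP => /forallP; apply: H.
Qed.

(** Each relation constrains one pair of bits: [r1] links the bit [= s1] to the bit [!= s0], [r2]
    makes the bit [!= s0] monotone, [r3] makes the bit [= s1] depend only on which coordinates are
    1. *)
Lemma XSP m (f : fS m) :
  reflect
    [/\ forall x y : m.-tuple S3,
          (forall i, tnth x i == s1 -> tnth y i != s0) ->
          f x == s1 -> f y != s0,
        forall x y : m.-tuple S3,
          (forall i, tnth x i != s0 -> tnth y i != s0) ->
          f x != s0 -> f y != s0
      & forall x y : m.-tuple S3,
          (forall i, (tnth x i == s1) = (tnth y i == s1)) ->
          (f x == s1) = (f y == s1)]
    (f \in XS m).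
Proof.
rewrite inE; apply: (iffP and3P) => -[].
  move=> /preservesP h1 /preservesP h2 /preservesP h3; split=> x y xy.
  - apply/implyP; rewrite -in_r1; apply: h1 => i.
    by rewrite in_r1; apply/implyP/xy.
  - apply/implyP; rewrite -in_r2; apply: h2 => i.
    by rewrite in_r2; apply/implyP/xy.
  - apply: (elimT eqP); rewrite -in_r3; apply: h3 => i.
    by rewrite in_r3 xy.
move=> h1 h2 h3; split; apply/preservesP => x y xy.
- rewrite in_r1; apply/implyP/h1 => i.
  by apply/implyP; rewrite -in_r1; apply: xy.
- rewrite in_r2; apply/implyP/h2 => i.
  by apply/implyP; rewrite -in_r2; apply: xy.
- rewrite in_r3; apply: (introT eqP); apply: h3 => i.
  by apply: (elimT eqP); rewrite -in_r3; apply: xy.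
Qed.

Lemma fcst0_XS m : fcst m s0 \in XS m.
Proof. by apply/XSP; split=> x y _; rewrite !ffunE. Qed.

Lemma fjoin_XS m (f g : fS m) :
  f \in XS m -> g \in XS m -> fjoin f g \in XS m.
Proof.
move=> /XSP[f1 f2 f3] /XSP[g1 g2 g3]; apply/XSP; split=> x y xy;
  rewrite !ffunE ?max_eq1 ?max_neq0.
- by case/orP => [/(f1 _ _ xy)-> // | /(g1 _ _ xy)->]; rewrite orbT.
- by case/orP => [/(f2 _ _ xy)-> // | /(g2 _ _ xy)->]; rewrite orbT.
- by rewrite (f3 _ _ xy) (g3 _ _ xy).
Qed.

(** * The morphisms [elem t c] and their join-irreducibility *)

Definition above m (c : m.-tuple bool) (x : m.-tuple S3) : bool :=
  [forall i, tnth c i ==> (tnth x i != s0)].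

Definition ones_are m (c : m.-tuple bool) (x : m.-tuple S3) : bool :=
  [forall i, tnth c i == (tnth x i == s1)].

(* The pair (up-set of c, {c}) for [t = true], (up-set of c, empty) for
   [t = false]. *)
Definition elem m (t : bool) (c : m.-tuple bool) : fS m :=
  [ffun x => if above c x then (if t && ones_are c x then s1 else sh) else s0].

Lemma ones_are_above m (c : m.-tuple bool) x : ones_are c x -> above c x.
Proof.
move/forallP => cx; apply/forallP => i; rewrite (eqP (cx i)).
by apply/implyP => /eqP->.
Qed.

Lemma elem_neq0 m t (c : m.-tuple bool) x : (elem t c x != s0) = above c x.
Proof. by rewrite ffunE; case: (above c x); case: (_ && _). Qed.

Lemma elem_eq1 m t (c : m.-tuple bool) x :
  (elem t c x == s1) = t && ones_are c x.
Proof.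
rewrite ffunE; case: (boolP (ones_are c x)) => [/ones_are_above->|].
  by case: t.
by rewrite andbF; case: (above c x).
Qed.

Lemma elem_XS m t (c : m.-tuple bool) : elem t c \in XS m.
Proof.
apply/XSP; split=> x y xy; rewrite ?elem_eq1 ?elem_neq0.
- case/andP=> _ /forallP cx; apply/forallP => i; rewrite (eqP (cx i)).
  by apply/implyP/xy.
- move/forallP => cx; apply/forallP => i; apply/implyP => ci.
  by apply: xy; move/implyP: (cx i); apply.
- by congr (_ && _); apply: eq_forallb => i; rewrite xy.
Qed.

(** A point that avoids [sh], so both of its bit vectors, of nonzero coordinates and of coordinates
    equal to 1, are [c]. *)
Definition corner m (c : m.-tuple bool) : m.-tuple S3 :=
  [tuple if tnth c i then s1 else s0 | i < m].

Lemma ones_are_corner m (c : m.-tuple bool) : ones_are c (corner c).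
Proof. by apply/forallP => i; rewrite tnth_mktuple; case: (tnth c i). Qed.

(** Two bits determine an element of [S3], and [a <= b] already gives one of the two implications
    for each bit. *)
Lemma S3_le_eq (a b : S3) :
  (a <= b)%O -> (b != s0 -> a != s0) -> (b == s1 -> a == s1) -> a = b.
Proof.
case: (S3P a) => ->; case: (S3P b) => -> //= _.
- by move/(_ isT).
- by move/(_ isT).
- by move=> _ /(_ isT).
Qed.

(* [corner c] is the point at which a morphism below [elem t c] has to agree
   with it in order to be equal to it. *)
Lemma elem_determined m t (c : m.-tuple bool) (g : fS m) :
  g \in XS m -> fle g (elem t c) -> g (corner c) = elem t c (corner c) ->
  g = elem t c.
Proof.
move=> /XSP[_ g2 g3] gle gc; apply/ffunP => x; apply: S3_le_eq => //.
  (* Monotonicity carries a nonzero value from [corner c] to every point above [c]; below, [r3]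
     carries the value 1 to every point with the same ones as [corner c]. *)
  rewrite elem_neq0 => /forallP cx; apply: (g2 (corner c)).
    move=> i; rewrite tnth_mktuple => ci; move/implyP: (cx i); apply.
    by case: (tnth c i) ci.
  by rewrite gc elem_neq0 ones_are_above ?ones_are_corner.
rewrite elem_eq1 => /andP[tT /forallP cx].
rewrite -(g3 (corner c)); first by rewrite gc elem_eq1 tT ones_are_corner.
move=> i; rewrite -(eqP (cx i)).
by move/forallP: (ones_are_corner c) => /(_ i)/eqP.
Qed.

(** In a chain the maximum of two values is one of them, so one joinand agrees with [elem t c] at
    [corner c], and this single point determines it. *)
Lemma elem_join_irreducible m t (c : m.-tuple bool) :
  join_irreducible (elem t c).
Proof.
split; first exact: elem_XS.
  move/ffunP/(_ (corner c))/eqP; apply/negP.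
  by rewrite [fcst _ _ _]ffunE elem_neq0 ones_are_above ?ones_are_corner.
move=> g k gX kX e.
have eE x : elem t c x = Order.max (g x) (k x) by rewrite e ffunE.
have gle : fle g (elem t c) by move=> x; rewrite eE le_max lexx.
have kle : fle k (elem t c) by move=> x; rewrite eE le_max lexx orbT.
have := eE (corner c); rewrite maxEle; case: ifP => _ ec.
  by right; apply/esym/elem_determined.
by left; apply/esym/elem_determined.
Qed.

(** * Every morphism is a join of such elements *)

Lemma elem_le m (t : bool) (c : m.-tuple bool) (f : fS m) :
  (forall x, above c x -> f x != s0) ->
  (t -> forall x, ones_are c x -> f x == s1) -> fle (elem t c) f.
Proof.
move=> f0 f1 x; rewrite ffunE; case: ifP => [/f0 fx|_]; last first.
  by case: (S3P (f x)) => ->.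
case: ifP => [/andP[tT /(f1 tT)/eqP-> //]|_].
by case: (S3P (f x)) fx => ->.
Qed.

Lemma XS_covered m (f : fS m) x :
  f \in XS m -> f x != s0 ->
  exists2 p : bool * m.-tuple bool,
    fle (elem p.1 p.2) f & elem p.1 p.2 x = f x.
Proof.
move=> /XSP[f1 f2 f3]; case: (S3P (f x)) => fx; rewrite fx => // _.
  (* Value [sh]: the nonzero bits of [x] generate the up-set, and [r2] keeps [f] nonzero on it. *)
  pose c := [tuple tnth x i != s0 | i < m].
  have cx : above c x by apply/forallP => i; rewrite tnth_mktuple implybb.
  exists (false, c); last by rewrite ffunE /= cx.
  apply: elem_le => //= y /forallP cy; apply: (f2 x); last by rewrite fx.
  by move=> i; have := cy i; rewrite tnth_mktuple => /implyP.
(* Value 1: the bits of [x] equal to 1 are used instead. Then [r1] makes [f] nonzero on the up-set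
   of [c], and [r3] makes it 1 wherever the ones are exactly [c]. *)
pose c := [tuple tnth x i == s1 | i < m].
have cx : ones_are c x by apply/forallP => i; rewrite tnth_mktuple.
exists (true, c); last by rewrite ffunE /= cx ones_are_above.
apply: elem_le => /= [y /forallP cy | _ y /forallP cy].
  apply: (f1 x); last by rewrite fx.
  by move=> i; have := cy i; rewrite tnth_mktuple => /implyP.
rewrite -(f3 x) ?fx // => i.
by have := cy i; rewrite tnth_mktuple => /eqP.
Qed.

Definition fjoins m (s : seq (fS m)) : fS m :=
  foldr (@fjoin m) (fcst m s0) s.

Lemma fjoins_XS m (s : seq (fS m)) : {subset s <= XS m} -> fjoins s \in XS m.
Proof.
elim: s => [_|g s IH sX] /=; first exact: fcst0_XS.
apply: fjoin_XS; first by apply: sX; rewrite mem_head.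
by apply: IH => k ks; apply: sX; rewrite inE ks orbT.
Qed.

Lemma fjoins_ge m (s : seq (fS m)) g : g \in s -> fle g (fjoins s).
Proof.
elim: s => //= k s IH; rewrite inE => /orP[/eqP->|/IH gs] x;
  by rewrite ffunE le_max ?lexx // gs orbT.
Qed.

Lemma fjoins_le m (s : seq (fS m)) f :
  (forall g, g \in s -> fle g f) -> fle (fjoins s) f.
Proof.
elim: s => [_|k s IH sf] x /=.
  by rewrite ffunE; case: (S3P (f x)) => ->.
rewrite ffunE ge_max sf ?mem_head //=.
by apply: IH => g gs; apply: sf; rewrite inE gs orbT.
Qed.

Lemma join_irreducible_fjoins m (s : seq (fS m)) f :
  join_irreducible f -> {subset s <= XS m} -> f = fjoins s -> f \in s.
Proof.
move=> [fX f0 fJ]; elim: s => [_ /f0 //|g s IH sX /= fE].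
have s'X : {subset s <= XS m} by move=> k ks; apply: sX; rewrite inE ks orbT.
rewrite inE; case: (fJ _ _ _ _ fE).
- by apply: sX; rewrite mem_head.
- exact: fjoins_XS.
- by move=> ->; rewrite eqxx.
- by move/(IH s'X)->; rewrite orbT.
Qed.

(** There are finitely many [elem t c], and a morphism is the join of those below it; a
    join-irreducible one must therefore be among them. *)
Lemma join_irreducibleP m (f : fS m) :
  join_irreducible f <-> exists t c, f = elem t c.
Proof.
split=> [fJ | [t [c ->]]]; last exact: elem_join_irreducible.
have fX : f \in XS m by case: fJ.
pose s : seq (fS m) :=
  [seq g : fS m <- [seq elem p.1 p.2 | p : bool * m.-tuple bool]
  | [forall x, (g x <= f x)%O]].
have sX : {subset s <= XS m}.
  move=> g; rewrite mem_filter => /andP[_ /mapP[p _ ->]]; exact: elem_XS.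
have fE : f = fjoins s.
  apply/ffunP => x; apply/eqP; rewrite eq_le; apply/andP; split; last first.
    by apply: fjoins_le => g; rewrite mem_filter => /andP[/forallP].
  case: (eqVneq (f x) s0) => [->|/(XS_covered fX)[p ple <-]].
    by case: (S3P (fjoins s x)) => ->.
  apply: fjoins_ge; rewrite mem_filter; apply/andP; split.
    exact/forallP.
  by apply/mapP; exists p; rewrite ?mem_enum.
have := join_irreducible_fjoins fJ sX fE.
by rewrite mem_filter => /andP[_ /mapP[[t c] _ ->]]; exists t, c.
Qed.

(** * Splitting off the first coordinate *)

Lemma forallb_ordS m (P : pred 'I_m.+1) :
  [forall i, P i] = P ord0 && [forall i, P (lift ord0 i)].
Proof.
apply/forallP/andP => [H | [P0 /forallP PS] i].
  by split => //; apply/forallP.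
by case: (unliftP ord0 i) => [j|] ->.
Qed.

Lemma above_cons m b (c : m.-tuple bool) a (x : m.-tuple S3) :
  above [tuple of b :: c] [tuple of a :: x] = (b ==> (a != s0)) && above c x.
Proof.
by rewrite /above forallb_ordS !tnth0; congr (_ && _);
  apply: eq_forallb => i; rewrite !tnthS.
Qed.

Lemma ones_are_cons m b (c : m.-tuple bool) a (x : m.-tuple S3) :
  ones_are [tuple of b :: c] [tuple of a :: x] =
    (b == (a == s1)) && ones_are c x.
Proof.
by rewrite /ones_are forallb_ordS !tnth0; congr (_ && _);
  apply: eq_forallb => i; rewrite !tnthS.
Qed.

Lemma triple_cons m (p0 ph p1 : fS m) a (x : m.-tuple S3) :
  triple p0 ph p1 [tuple of a :: x] =
    if a == s0 then p0 x else if a == sh then ph x else p1 x.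
Proof.
rewrite ffunE theadE.
by have -> : [tuple of behead [tuple of a :: x]] = x by apply: val_inj.
Qed.

(** A first coordinate [s0] is not above the bit [true]; [sh] is above it but is not a one, so the
    value 1 drops to [sh]; [s1] passes both tests. *)
Lemma elem_cons_true m t (c : m.-tuple bool) :
  elem t [tuple of true :: c] =
    triple (fcst m s0) (fmeet (elem t c) (fcst m sh)) (elem t c).
Proof.
apply/ffunP => x; case/tupleP: x => a x.
rewrite triple_cons !ffunE above_cons ones_are_cons.
by case: (S3P a) => -> /=; case: (above c x); case: t; case: (ones_are c x).
Qed.

(** The bit [false] puts no condition on being above, but a first coordinate [s1] is a one too many,
    so only there does the value 1 drop to [sh]. *)
Lemma elem_cons_false m t (c : m.-tuple bool) :
  elem t [tuple of false :: c] =
    triple (elem t c) (elem t c) (fmeet (elem t c) (fcst m sh)).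
Proof.
apply/ffunP => x; case/tupleP: x => a x.
rewrite triple_cons !ffunE above_cons ones_are_cons.
by case: (S3P a) => -> /=; case: (above c x); case: t; case: (ones_are c x).
Qed.

Lemma join_irreducible_triple m (f : fS m.+1) :
  join_irreducible f <->
  exists2 psi : fS m, join_irreducible psi &
    f = triple (fcst m s0) (fmeet psi (fcst m sh)) psi \/
    f = triple psi psi (fmeet psi (fcst m sh)).
Proof.
split=> [/join_irreducibleP[t [c ->]] | [psi /join_irreducibleP[t [c ->]]]].
  case/tupleP: c => b c; exists (elem t c); first exact: elem_join_irreducible.
  by case: b; [left; apply: elem_cons_true | right; apply: elem_cons_false].
by rewrite -elem_cons_true -elem_cons_false => -[] ->;
  apply: elem_join_irreducible.
Qed.

Lemma triple_meet_Pi1 m (psi : fS m) :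
  fmeet (triple psi psi psi) (Pi1 m) =
    triple (fcst m s0) (fmeet psi (fcst m sh)) psi.
Proof.
apply/ffunP => x; case/tupleP: x => a x.
rewrite ffunE !triple_cons !ffunE theadE.
by case: (S3P a) => -> /=; case: (S3P (psi x)) => ->.
Qed.

(** Since the bar sends 0 and [h] to 1 and sends 1 to [h], the meet cuts only the last component,
    and only down to [h]. *)
Lemma triple_meet_bar_Pi1 m (psi : fS m) :
  fmeet (triple psi psi psi) (fbar (Pi1 m)) =
    triple psi psi (fmeet psi (fcst m sh)).
Proof.
apply/ffunP => x; case/tupleP: x => a x.
rewrite ffunE !triple_cons !ffunE theadE.
by case: (S3P a) => -> /=; case: (S3P (psi x)) => ->.
Qed.

(** * Triples bounded by [h], and the theorem *)

Lemma fmeet_le m (f g : fS m) : fle f g -> fmeet f g = f.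
Proof. by move=> fg; apply/ffunP => x; rewrite ffunE; apply/min_idPl. Qed.

Lemma fle_triple m (p0 ph p1 : fS m) a :
  fle (triple p0 ph p1) (fcst m.+1 a) <->
  [/\ fle p0 (fcst m a), fle ph (fcst m a) & fle p1 (fcst m a)].
Proof.
split=> [H | [H0 Hh H1] x].
  by split=> x; [have := H [tuple of s0 :: x] | have := H [tuple of sh :: x]
    | have := H [tuple of s1 :: x]]; rewrite triple_cons !ffunE.
have cE y : fcst m.+1 a x = fcst m a y by rewrite !ffunE.
case/tupleP: x cE => b x cE; rewrite triple_cons (cE x).
by case: ifP => // _; case: ifP.
Qed.

(** Both triples contain [psi] uncut, and their remaining components are at most [h] as soon as
    [psi] is. This lets the case split on [f] pass to [psi]. *)
Lemma fle_triple_cases m (psi : fS m) (f : fS m.+1) :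
  f = triple (fcst m s0) (fmeet psi (fcst m sh)) psi \/
  f = triple psi psi (fmeet psi (fcst m sh)) ->
  fle f (fcst m.+1 sh) <-> fle psi (fcst m sh).
Proof.
have meet_le : fle (fmeet psi (fcst m sh)) (fcst m sh).
  by move=> x; rewrite ffunE ge_min lexx orbT.
have cst_le : fle (fcst m s0) (fcst m sh) by move=> x; rewrite !ffunE.
by case=> ->; split=> [/fle_triple[] | psi_le] //; apply/fle_triple.
Qed.

Theorem theorem2 (n : nat) (hn : 1 < n.+1) (Phi : fS n.+1)
    (hPhi : Phi \in XS n.+1) :
  [/\ (join_irreducible Phi <->
         exists2 psi : fS n, join_irreducible psi &
           Phi = triple (fcst n s0) (fmeet psi (fcst n sh)) psi \/
           Phi = triple psi psi (fmeet psi (fcst n sh)))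
      /\
      (join_irreducible Phi <->
         exists2 psi : fS n, join_irreducible psi &
           Phi = fmeet (triple psi psi psi) (Pi1 n) \/
           Phi = fmeet (triple psi psi psi) (fbar (Pi1 n))),
      fle Phi (fcst n.+1 sh) ->
        (join_irreducible Phi <->
           exists psi : fS n,
             [/\ join_irreducible psi, fle psi (fcst n sh) &
                 Phi = triple (fcst n s0) psi psi \/
                 Phi = triple psi psi psi])
    & ~ fle Phi (fcst n.+1 sh) ->
        (join_irreducible Phi <->
           exists psi : fS n,
             [/\ join_irreducible psi, ~ fle psi (fcst n sh) &
                 Phi = triple (fcst n s0) (fmeet psi (fcst n sh)) psi \/
                 Phi = triple psi psi (fmeet psi (fcst n sh))])].
Proof.
have base := join_irreducible_triple Phi.
split.
- split=> //; apply: (iff_trans base).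
  by split=> -[psi psiJ E]; exists psi => //; move: E;
    rewrite triple_meet_Pi1 triple_meet_bar_Pi1.
- move=> Phi_le; apply: (iff_trans base); split=> [[psi psiJ E]|[psi [psiJ psi_le E]]].
    have psi_le : fle psi (fcst n sh) by apply/(fle_triple_cases E).
    (* For [psi] below [h] the cut [fmeet psi (fcst n sh)] is [psi] itself, which turns the general
       triples into the simpler ones. *)
    by exists psi; split=> //; move: E; rewrite fmeet_le.
  by exists psi => //; rewrite fmeet_le.
- move=> Phi_nle; apply: (iff_trans base); split=> [[psi psiJ E]|[psi [psiJ _ E]]].
    by exists psi; split=> // /(fle_triple_cases E).
  by exists psi.
Qed.
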